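(* Let $\mathfrak{g}$ be a complex semisimple Lie algebra, $\mathfrak{h}$ a Cartan subalgebra with Weyl group $W$, $\mathfrak{C}$ a Chevalley basis determined by $\mathfrak{h}$, $\mathfrak{g}_0$ the corresponding compact real form, and let $\mathfrak{n}=V\oplus\mathfrak{g}$ be the complex 2-step nilpotent Lie algebra described in the context. For each $\sigma\in W$ let $T_\sigma\in GL(V)$ and $\varphi_\sigma\in GL(\mathfrak{g})$ be the maps defined in the context, and let $\zeta_\sigma:\mathfrak{n}\to\mathfrak{n}$ be the linear map given by $\zeta_\sigma=T_\sigma$ on $V$ and $\zeta_\sigma=\varphi_\sigma$ on $\mathfrak{g}$. Then $\zeta_\sigma$ is an automorphism of $\mathfrak{n}$ that is unitary with respect to any $\mathfrak{g}_0$-invariant Hermitian inner product on $\mathfrak{n}$ for which $V$ and $\mathfrak{g}$ are orthogonal.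
   Context: For a root $\alpha\in\Phi$ of $\mathfrak{h}$, $\tau_\alpha=2H_\alpha/B(H_\alpha,H_\alpha)\in\mathfrak{h}$, where $B$ is the Killing form and $B(H,H_\alpha)=\alpha(H)$ for $H\in\mathfrak{h}$. $\Delta$ is a base of $\Phi$, $\Phi^+$ the positive roots. A Chevalley basis determined by $\mathfrak{h}$ is a basis $\mathfrak{C}=\{X_\beta:\beta\in\Phi;\ \tau_\alpha:\alpha\in\Delta\}$ of $\mathfrak{g}$ with $X_\beta\in\mathfrak{g}_\beta$, $[X_\alpha,X_{-\alpha}]=\tau_\alpha$ for all $\alpha\in\Phi$, and, whenever $\alpha,\beta,\alpha+\beta\in\Phi$, $[X_\alpha,X_\beta]=C_{\alpha,\beta}X_{\alpha+\beta}$ with $C_{\alpha,\beta}=-C_{-\alpha,-\beta}$. The corresponding compact real form is $\mathfrak{g}_0=\mathbb{R}\text{-span}\{i\tau_\alpha\ (\alpha\in\Delta),\ X_\beta-X_{-\beta},\ iX_\beta+iX_{-\beta}\ (\beta\in\Phi^+)\}$. $V$ is a finite dimensional complex $\mathfrak{g}$-module, and $B^*$ is a nondegenerate symmetric complex bilinear form on $V\oplus\mathfrak{g}$ such that $V\perp\mathfrak{g}$, $B^*(Xv,v')+B^*(v,Xv')=0$ for $v,v'\in V$, $X\in\mathfrak{g}$, and $B^*(\mathrm{ad}X(Y),Z)+B^*(Y,\mathrm{ad}X(Z))=0$ for $X,Y,Z\in\mathfrak{g}$. The bracket of $\mathfrak{n}=V\oplus\mathfrak{g}$ is defined by: $\mathfrak{g}$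 is central, $[\mathfrak{n},\mathfrak{n}]\subseteq\mathfrak{g}$, and $B^*([v,v'],Z)=B^*(Zv,v')$ for $v,v'\in V$, $Z\in\mathfrak{g}$. The Weyl group is generated by the reflections $\sigma_\alpha(H)=H-\alpha(H)\tau_\alpha$ on $\mathfrak{h}$, $\alpha\in\Phi$. For $\alpha\in\Phi$ let $T_\alpha=\exp(X_\alpha)\exp(-X_{-\alpha})\exp(X_\alpha)\in GL(V)$ ($X_{\pm\alpha}$ acting on $V$) and $\varphi_\alpha=\exp(\mathrm{ad}X_\alpha)\exp(-\mathrm{ad}X_{-\alpha})\exp(\mathrm{ad}X_\alpha)\in GL(\mathfrak{g})$ (the same construction for the adjoint module). For $\sigma\in W$ choose an expression $\sigma=\sigma_{\beta_1}\circ\cdots\circ\sigma_{\beta_k}$ with $\beta_i\in\Phi$ and put $T_\sigma=T_{\beta_1}\circ\cdots\circ T_{\beta_k}$, $\varphi_\sigma=\varphi_{\beta_1}\circ\cdots\circ\varphi_{\beta_k}$ (same expression for both). A Hermitian inner product on $\mathfrak{n}$ is $\mathfrak{g}_0$-invariant if every $X\in\mathfrak{g}_0$, acting on $\mathfrak{n}$ by the module action on $V$ and by $\mathrm{ad}X$ on $\mathfrak{g}$, is skew-Hermitian. *)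

(* Defs.v *)
From HB Require Import structures.
From mathcomp Require Import all_boot all_order all_algebra.
From mathcomp Require Import all_classical all_reals all_analysis.
From mathcomp Require Import complex.

Set Implicit Arguments.
Unset Strict Implicit.
Unset Printing Implicit Defensive.

Import Order.TTheory GRing.Theory Num.Theory passmx.
Import numFieldNormedType.Exports.

Local Open Scope ring_scope.
Local Open Scope classical_set_scope.
Local Open Scope complex_scope.

Section Endomorphisms.
Context {K : numFieldType}.

(* Entrywise limit of the partial sums of the exponential series; the entries
   are taken in K, so that every n (including n = 0) is covered. *)
Definition mexp n (A : 'M[K]_n) : 'M[K]_n :=
  \matrix_(i, j) limn (series (fun k => (k`!%:R^-1 *: A ^+ k) i j)).

Definition lexp (U : vectType K) (f : 'End(U)) : 'End(U) :=
  let e := vbasis {:U} in hommx e e (mexp (mxof e e f)).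

Definition ltrace (U : vectType K) (f : 'End(U)) : K :=
  let e := vbasis {:U} in \tr (mxof e e f).

End Endomorphisms.

Section LieAlgebra.
Context {K : numFieldType} {L : vectType K}.
Variable br : {bilinear L -> L -> L}.

Definition is_lie_bracket : Prop :=
  (forall x, br x x = 0) /\
  (forall x y z, br x (br y z) + br y (br z x) + br z (br x y) = 0).

Definition ad (x : L) : 'End(L) := linfun (br x).

Definition killing (x y : L) : K := ltrace (ad x \o ad y)%VF.

Definition bracket_space (U W : {vspace L}) : {vspace L} :=
  <<[seq br u w | u <- vbasis U, w <- vbasis W]>>%VS.

Definition is_ideal (I : {vspace L}) : Prop := (bracket_space fullv I <= I)%VS.

Definition is_solvable (U : {vspace L}) : Prop :=
  exists k, iter k (fun W => bracket_space W W) U = 0%VS.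

Definition is_nilpotent (U : {vspace L}) : Prop :=
  exists k, iter k (bracket_space U) U = 0%VS.

Definition is_semisimple : Prop :=
  forall I, is_ideal I -> is_solvable I -> I = 0%VS.

Definition is_cartan_subalgebra (h : {vspace L}) : Prop :=
  [/\ (bracket_space h h <= h)%VS,
      is_nilpotent h &
      forall x, (forall y, y \in h -> br x y \in h) -> x \in h].

Definition lie_automorphism (f : L -> L) : Prop :=
  [/\ linear f, bijective f & {morph f : x y / br x y}].

End LieAlgebra.

Section Roots.
Context {R : realType} {g : vectType R[i]}.
Variables (br : {bilinear g -> g -> g}) (h : {vspace g}).

Definition dual : vectType R[i] := 'Hom(subvs_of h, R[i]^o).

Definition root_space (a : dual) : set g :=
  [set x | forall H : subvs_of h, br (vsval H) x = a H *: x].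

Definition is_root (a : dual) : Prop :=
  a != 0 /\ exists2 x, root_space a x & x != 0.

(* H_a, uniquely determined when the Killing form is nondegenerate on h. *)
Definition root_vec (a : dual) : subvs_of h :=
  xget 0 [set Ha | forall H, killing br (vsval H) (vsval Ha) = a H].

Definition tau (a : dual) : subvs_of h :=
  let Ha := root_vec a in (2 / killing br (vsval Ha) (vsval Ha)) *: Ha.

Definition reflection (a : dual) (H : subvs_of h) : subvs_of h :=
  H - (a H : R[i]) *: tau a.

Inductive weyl_group : (subvs_of h -> subvs_of h) -> Prop :=
| weyl_id : weyl_group id
| weyl_refl a : is_root a -> weyl_group (reflection a)
| weyl_comp s t : weyl_group s -> weyl_group t -> weyl_group (s \o t)
| weyl_inv s t : weyl_group s -> cancel s t -> cancel t s -> weyl_group t.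

Definition refl_word (bs : seq dual) : subvs_of h -> subvs_of h :=
  foldr (fun b s => reflection b \o s) id bs.

Definition nonneg_comb (D : seq dual) (b : dual) : Prop :=
  exists k : 'I_(size D) -> nat, b = \sum_(i < size D) D`_i *+ k i.

(* A base is a basis of the real span of the roots, hence the linear
   independence over the reals. *)
Definition is_base (D : seq dual) : Prop :=
  [/\ forall a, a \in D -> is_root a,
      forall c : 'I_(size D) -> R,
        \sum_(i < size D) (c i)%:C *: D`_i = 0 -> forall i, c i = 0 &
      forall b, is_root b -> nonneg_comb D b \/ nonneg_comb D (- b)].

Definition is_positive_root (D : seq dual) (b : dual) : Prop :=
  is_root b /\ nonneg_comb D b.

(* Only the values of X at the roots are relevant. *)
Definition is_chevalley_basis (D : seq dual) (X : dual -> g) : Prop :=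
  [/\ exists Phi : seq dual,
        [/\ uniq Phi, forall a, a \in Phi <-> is_root a &
            basis_of fullv ([seq X b | b <- Phi] ++
                            [seq vsval (tau a) | a <- D])],
      forall b, is_root b -> root_space b (X b),
      forall a, is_root a -> br (X a) (X (- a)) = vsval (tau a) &
      exists C : dual -> dual -> R[i],
        forall a b, is_root a -> is_root b -> is_root (a + b) ->
          br (X a) (X b) = C a b *: X (a + b) /\ C a b = - C (- a) (- b)].

Definition real_span (S : set g) : set g :=
  [set x | exists n (c : 'I_n -> R) (v : 'I_n -> g),
     (forall i, S (v i)) /\ x = \sum_i (c i)%:C *: v i].

Definition compact_form (D : seq dual) (X : dual -> g) : set g :=
  real_span
    ([set 'i *: vsval (tau a) | a in [set a | a \in D]] `|`
     [set X b - X (- b) | b in is_positive_root D] `|`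
     [set 'i *: X b + 'i *: X (- b) | b in is_positive_root D]).

End Roots.

Section Lifts.
Context {R : realType} {g : vectType R[i]} {h : {vspace g}}.
Context {U : vectType R[i]}.
Variables (rho : g -> 'End(U)) (X : dual h -> g).

Definition root_lift (a : dual h) : 'End(U) :=
  (lexp (rho (X a)) \o lexp (- rho (X (- a))) \o lexp (rho (X a)))%VF.

Definition word_lift (bs : seq (dual h)) : 'End(U) :=
  foldr (fun b f => (root_lift b \o f)%VF) \1%VF bs.

End Lifts.

Section NilpotentExtension.
Context {R : realType} {g V : vectType R[i]}.
Variables (br : {bilinear g -> g -> g}) (rho : {linear g -> 'End(V)}).
Local Notation n := (V * g)%type.

Definition is_lie_module : Prop :=
  forall x y v, rho (br x y) v = rho x (rho y v) - rho y (rho x v).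

Definition is_invariant_form (B : {symmetric n}) : Prop :=
  [/\ nondegenerate B,
      forall v Y, B (v, 0) (0, Y) = 0,
      forall X v v', B (rho X v, 0) (v', 0) + B (v, 0) (rho X v', 0) = 0 &
      forall X Y Z, B (0, br X Y) (0, Z) + B (0, Y) (0, br X Z) = 0].

Definition is_nil_bracket (B : {symmetric n}) (brn : {bilinear n -> n -> n}) :
    Prop :=
  [/\ is_lie_bracket brn,
      forall Y x, brn (0, Y) x = 0,
      forall x y, (brn x y).1 = 0 &
      forall v v' Z, B (brn (v, 0) (v', 0)) (0, Z) = B (rho Z v, 0) (v', 0)].

Definition nact (X : g) (x : n) : n := (rho X x.1, br X x.2).

Definition is_invariant_product (g0 : set g) (ip : {dot n for Num.conj}) :
    Prop :=
  forall X, g0 X -> forall x y, ip (nact X x) y = - ip x (nact X y).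

End NilpotentExtension.

(* Main.v *)
From HB Require Import structures.
Require Import Defs.
From mathcomp Require Import all_boot all_order all_algebra.
From mathcomp Require Import all_classical all_reals all_analysis.
From mathcomp Require Import complex ring.

Set Implicit Arguments.
Unset Strict Implicit.
Unset Printing Implicit Defensive.

Import Order.TTheory GRing.Theory Num.Theory passmx.
Import numFieldNormedType.Exports.
Local Open Scope ring_scope.

(** Every map zeta_sigma is a product, along the chosen word, of operators
    T_b = exp(X_b) exp(-X_{-b}) exp(X_b) taken in one and the same module: the
    sum V + g, on which x acts by rho x on V and by ad x on g ([nrep]).  So a
    single root b has to be understood.

    Automorphism.  Invariance of B* together with its nondegeneracy on g says
    that the action of g on n is by derivations ([nbracket_derivation]), and
    the exponential of a nilpotent derivation is an automorphism.  The latter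
    is a case of [lexp_leibniz]: a Leibniz rule for a bilinear map exponentiates
    to equivariance.  The same principle applied to the action of g on a module
    gives T (z v) = (phi z) (T v) ([sl2_lift_module]).

    Unitarity.  Skewness of X_b - X_{-b} and of i X_b + i X_{-b} amounts to
    the adjointness of X = X_b and Y = X_{-b}.  The adjoint of T_b is then
    exp(Y) exp(-X) exp(Y), and its inverse is exp(-X) exp(Y) exp(-X).  They
    agree because of the relation
      exp(X) exp(-Y) exp(X) = exp(-Y) exp(X) exp(-Y)
    valid in every sl2-module ([sl2_lift_braid]): T_b conjugates X into -Y,
    hence exp(X) into exp(-Y), and -Y into X.

    Both parts use that (X_b, X_{-b}, tau_b) is an sl2-triple for every root b,
    that is, that -b is a root and that B(H_b, H_b) does not vanish
    ([root_sl2_triple]).  The Chevalley basis gives this without appeal to the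
    criterion of Cartan.  It diagonalizes ad h, so that
    B(H, H') is the sum of c(H) c(H') over the roots c.  For a simple root a
    the vector tau_a is nonzero, being a basis element, and this is enough to
    have an sl2-triple; the weights of sl2 are integers, so every root takes
    real values at the vectors H_a, and therefore at H_b for every root b.
    Now B(H_b, H_b) is a sum of squares of real numbers, not all zero.

    All exponentials are finite sums: [H, X_b] = b(H) X_b with b(H) nonzero
    makes X_b act nilpotently on every module ([shift_nilpotent]). *)

(** * Exponentials of nilpotent endomorphisms *)

Lemma sum_truncate (U : nmodType) (F : nat -> U) M N :
  (M <= N)%N -> (forall k, (M <= k)%N -> F k = 0) ->
  \sum_(k < N) F k = \sum_(k < M) F k.
Proof.
move=> leMN F0; rewrite -!(big_mkord predT F) (big_cat_nat _ leMN) //=.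
rewrite [X in _ + X]big_nat_cond [X in _ + X]big1 ?addr0 //.
by move=> k /andP[/andP[leMk _] _]; rewrite F0.
Qed.

Lemma sum_triangle (V : nmodType) (s : nat -> nat -> V) M :
  \sum_(n < M) \sum_(i < n.+1) s i (n - i)%N =
  \sum_(i < M) \sum_(j < M - i) s i j.
Proof.
elim: M => [|M IHM]; first by rewrite !big_ord0.
rewrite big_ord_recr /= {}IHM [RHS]big_ord_recr /= subSn // subnn big_ord1.
rewrite [X in _ + X]big_ord_recr /= subnn addrA -big_split /=.
congr (_ + _); apply: eq_bigr => i _.
by rewrite subSn 1?ltnW // big_ord_recr.
Qed.

Section NilpotentExponential.
Context {K : numFieldType}.

Lemma mexp_nilpotent n (A : 'M[K]_n) N :
  A ^+ N = 0 -> mexp A = \sum_(k < N) k`!%:R^-1 *: A ^+ k.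
Proof.
move=> AN0; apply/matrixP => i j; rewrite mxE summxE.
apply: (@lim_near_cst K); first exact: norm_hausdorff.
exists N => // m /= leNm; rewrite /series /= big_mkord.
apply: (sum_truncate (F := fun k => (k`!%:R^-1 *: A ^+ k) i j)) => // k leNk.
by rewrite -(subnK leNk) exprD AN0 mulr0 scaler0 mxE.
Qed.

Definition nilpotent_end (U : vectType K) (f : 'End(U)) : Prop :=
  exists N, forall v, iter N f v = 0.

Lemma iter_end0 (U : vectType K) (f : 'End(U)) n : iter n f 0 = 0.
Proof. by elim: n => //= n ->; rewrite linear0. Qed.

Lemma iter_end_vanish (U : vectType K) (f : 'End(U)) N v n :
  iter N f v = 0 -> (N <= n)%N -> iter n f v = 0.
Proof. by move=> fN0 /subnK <-; rewrite iterD fN0 iter_end0. Qed.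

Lemma rVof_iter (U : vectType K) (f : 'End(U)) (e := vbasis {:U}) k v :
  rVof e (iter k f v) = rVof e v *m mxof e e f ^+ k.
Proof.
have eb : basis_of {:U} e by apply: vbasisP.
elim: k => [|k IHk] /=; first by rewrite expr0 mulmx1.
by rewrite (rVof_app e eb) IHk exprSr mulmxA.
Qed.

(** Any N with f^N v = 0 may be used, not only a nilpotency index of f: this is
    what makes explicit computations on a given vector short. *)
Lemma lexpE (U : vectType K) (f : 'End(U)) N v :
  nilpotent_end f -> iter N f v = 0 ->
  lexp f v = \sum_(k < N) k`!%:R^-1 *: iter k f v.
Proof.
move=> [M fM0] fN0; rewrite /lexp.
set e := vbasis {:U}; have eb : basis_of {:U} e by apply: vbasisP.
have AM0 : mxof e e f ^+ M = 0.
  apply/row_matrixP => i; rewrite rowE row0 -[delta_mx 0 i](vecofK eb).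
  by rewrite -rVof_iter fM0 linear0.
rewrite (mexp_nilpotent AM0) (hommxE eb eb).
apply: (can_inj (rVofK eb)); rewrite (vecofK eb) mulmx_sumr.
under eq_bigr do rewrite -scalemxAr -rVof_iter -linearZ.
rewrite -linear_sum; congr (rVof _ _).
pose F k := k`!%:R^-1 *: iter k f v.
have trunc P : iter P f v = 0 -> (P <= M + N)%N ->
    \sum_(k < M + N) F k = \sum_(k < P) F k.
  move=> fP0 leP; apply: sum_truncate => // k lePk.
  by rewrite /F (iter_end_vanish fP0 lePk) scaler0.
by rewrite -[LHS](trunc M) ?leq_addr // (trunc N) ?leq_addl.
Qed.

Lemma iter_intertwine (U W : vectType K) (f : 'End(U)) (f' : 'End(W))
    (t : U -> W) k u :
  (forall u, t (f u) = f' (t u)) -> t (iter k f u) = iter k f' (t u).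
Proof. by move=> tf; elim: k => //= k IHk; rewrite tf IHk. Qed.

Lemma lexp_intertwine (U W : vectType K) (f : 'End(U)) (f' : 'End(W))
    (t : {linear U -> W}) u :
  nilpotent_end f -> nilpotent_end f' -> (forall u, t (f u) = f' (t u)) ->
  t (lexp f u) = lexp f' (t u).
Proof.
move=> nf nf' tf; have [N fN0] := nf.
have f'N0 : iter N f' (t u) = 0 by rewrite -(iter_intertwine _ _ tf) fN0 linear0.
rewrite (lexpE nf (fN0 u)) (lexpE nf' f'N0) linear_sum.
apply: eq_bigr => k _; rewrite linearZ /=; congr (_ *: _); exact: iter_intertwine.
Qed.

Section Leibniz.
Context {U W Z : vectType K}.
Variables (D : 'End(U)) (A : 'End(W)) (C : 'End(Z)) (b : U -> W -> Z).
Hypothesis b_linl : forall w, linear (b^~ w).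
Hypothesis b_linr : forall u, linear (b u).
Hypothesis leibniz : forall u w, C (b u w) = b (D u) w + b u (A w).

Lemma iter_leibniz n u w :
  iter n C (b u w) =
  \sum_(i < n.+1) b (iter i D u) (iter (n - i) A w) *+ 'C(n, i).
Proof.
elim: n => [|n IHn]; first by rewrite big_ord1 /= bin0 mulr1n.
rewrite iterS IHn linear_sum.
under eq_bigr do rewrite linearMn /= leibniz mulrnDl.
rewrite big_split /= [RHS]big_ord_recl /= bin0 mulr1n.
under [X in _ = _ + X]eq_bigr do rewrite /bump /= add1n binS mulrnDr subSS.
rewrite [X in _ = _ + X]big_split /= addrA addrC; congr (_ + _).
rewrite big_ord_recl /= bin0 mulr1n !subn0; congr (_ + _).
rewrite [RHS]big_ord_recr /= bin_small // mulr0n addr0.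
by apply: eq_bigr => i _; rewrite /bump /= -[A _]iterS subnSK.
Qed.

(** When C (b u w) = b (D u) w + b u (A w), the divided powers satisfy
    C^n/n! b u w = sum over i + j = n of b (D^i/i! u) (A^j/j! w); summing over n
    gives the Cauchy product of the two exponentials.  With Z the module and b
    the action, this is exp(x) (z v) = (exp(ad x) z) (exp(x) v); with b a bracket
    and C = D = A a derivation, it says that exp(C) is a morphism. *)
Lemma lexp_leibniz u w :
  nilpotent_end D -> nilpotent_end A -> nilpotent_end C ->
  lexp C (b u w) = b (lexp D u) (lexp A w).
Proof.
move=> nD nA nC; have [N1 D0] := nD; have [N2 A0] := nA; have [N3 C0] := nC.
have b0l x : b 0 x = 0.
  by have := b_linl x (-1) 0 0; rewrite /= scaler0 addr0 scaleN1r addNr.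
have b0r x : b x 0 = 0.
  by have := b_linr x (-1) 0 0; rewrite /= scaler0 addr0 scaleN1r addNr.
have bZl c x y : b (c *: x) y = c *: b x y.
  by have := b_linl y c x 0; rewrite /= !addr0 b0l addr0.
have bZr c x y : b x (c *: y) = c *: b x y.
  by have := b_linr x c y 0; rewrite /= !addr0 b0r addr0.
have bsl n (F : 'I_n -> U) y : b (\sum_i F i) y = \sum_i b (F i) y.
  elim/big_rec2: _ => [|i y1 y2 _ <-]; first exact: b0l.
  by have := b_linl y 1 (F i) y2; rewrite /= !scale1r.
have bsr n (F : 'I_n -> W) x : b x (\sum_i F i) = \sum_i b x (F i).
  elim/big_rec2: _ => [|i y1 y2 _ <-]; first exact: b0r.
  by have := b_linr x 1 (F i) y2; rewrite /= !scale1r.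
(* With all sums cut at M = 2N, a product of terms of indices i + j >= M has
   i >= N or j >= N, hence vanishes: the square and the triangle agree. *)
pose N := (N1 + N2 + N3)%N; pose M := (N + N)%N.
have DM k x : (N <= k)%N -> iter k D x = 0.
  move=> /(leq_trans _) leNk; apply: (iter_end_vanish (D0 x)).
  by rewrite leNk // /N -addnA leq_addr.
have AM k x : (N <= k)%N -> iter k A x = 0.
  move=> /(leq_trans _) leNk; apply: (iter_end_vanish (A0 x)).
  by rewrite leNk // /N addnAC leq_addl.
have CM k x : (N <= k)%N -> iter k C x = 0.
  move=> /(leq_trans _) leNk; apply: (iter_end_vanish (C0 x)).
  by rewrite leNk // /N leq_addl.
have leNM : (N <= M)%N by rewrite leq_addr.
rewrite (lexpE nC (CM M _ leNM)) (lexpE nA (AM M _ leNM)) (lexpE nD (DM M _ leNM)).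
pose s i j := (i`!%:R^-1 * j`!%:R^-1) *: b (iter i D u) (iter j A w).
transitivity (\sum_(n < M) \sum_(i < n.+1) s i (n - i)%N).
  apply: eq_bigr => n _; rewrite iter_leibniz scaler_sumr; apply: eq_bigr => i _.
  rewrite /s -[b _ _ *+ _]scaler_nat scalerA; congr (_ *: _).
  have le_in : (i <= n)%N by rewrite -ltnS.
  have nz k : k`!%:R != 0 :> K by rewrite pnatr_eq0 -lt0n fact_gt0.
  rewrite -(bin_fact le_in) !natrM !invfM.
  by rewrite [LHS]mulrC mulVKf // pnatr_eq0 -lt0n bin_gt0 le_in.
rewrite (sum_triangle s) bsl; apply: eq_bigr => i _; rewrite bZl bsr scaler_sumr.
under [RHS]eq_bigr do rewrite bZr scalerA.
rewrite -/(s i _) (sum_truncate (F := s i) (leq_subr i M)) // => j leMj.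
have [/DM D00|/ltnW leiN] := leqP N i; first by rewrite /s D00 b0l scaler0.
rewrite /s AM ?b0r ?scaler0 // (leq_trans _ leMj) //.
by rewrite leq_subRL ?leq_add2r // (leq_trans leiN).
Qed.

End Leibniz.

Lemma iterN_end (U : vectType K) (f : 'End(U)) k v :
  iter k (- f) v = (-1) ^+ k *: iter k f v.
Proof.
elim: k v => [|k IHk] v /=; first by rewrite expr0 scale1r.
by rewrite IHk opp_lfunE linearZ /= exprS mulN1r scaleNr.
Qed.

Lemma nilpotent_endN (U : vectType K) (f : 'End(U)) :
  nilpotent_end f -> nilpotent_end (- f).
Proof. by move=> [N f0]; exists N => v; rewrite iterN_end f0 scaler0. Qed.

Definition precomp (U : vectType K) (f p : 'End(U)) : 'End(U) := (p \o f)%VF.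

Fact precomp_is_linear (U : vectType K) (f : 'End(U)) : linear (precomp f).
Proof. by move=> c p q; rewrite /precomp comp_lfunDl comp_lfunZl. Qed.

HB.instance Definition _ (U : vectType K) (f : 'End(U)) :=
  GRing.isSemilinear.Build K _ _ _ (precomp f)
    (GRing.semilinear_linear (precomp_is_linear f)).

Lemma iter_precomp (U : vectType K) (f p : 'End(U)) k v :
  iter k (linfun (precomp f)) p v = p (iter k f v).
Proof.
by elim: k v => [|k IHk] v //; rewrite iterS lfunE /= comp_lfunE IHk -iterSr.
Qed.

(** The evaluation map p, w |-> p w satisfies the Leibniz rule
    0 = (- p f) w + p (f w), in which p |-> - p f exponentiates to
    p |-> p exp(-f); [lexp_leibniz] at p = 1 is the claim. *)
Lemma lexpNK (U : vectType K) (f : 'End(U)) :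
  nilpotent_end f -> cancel (lexp f) (lexp (- f)).
Proof.
move=> nf v; have nNf := nilpotent_endN nf; have [N f0] := nf.
pose D := linfun (precomp (- f)).
have D0 p : iter N D p = 0.
  by apply/lfunP => w; rewrite iter_precomp iterN_end f0 scaler0 !linear0 lfunE.
have nD : nilpotent_end D by exists N.
have n0 : nilpotent_end (0 : 'End(U)) by exists 1%N => w; rewrite /= lfunE.
have -> : lexp (- f) (lexp f v) = lexp D \1%VF (lexp f v).
  rewrite (lexpE nD (D0 _)) sum_lfunE (@lexpE _ _ N) //; last first.
    by rewrite iterN_end f0 scaler0.
  by apply: eq_bigr => k _; rewrite scale_lfunE iter_precomp id_lfunE.
rewrite -(@lexp_leibniz _ _ _ D f 0 (fun p w => p w)) //.
- by rewrite (@lexpE _ _ 1%N) ?big_ord1 ?fact0 ?invr1 ?scale1r ?id_lfunE //= lfunE.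
- by move=> w c p q /=; rewrite add_lfunE scale_lfunE.
- by move=> p c w w'; rewrite linearP.
by move=> p w; rewrite lfunE /= lfunE /= comp_lfunE opp_lfunE linearN addNr.
Qed.

Lemma lexpKN (U : vectType K) (f : 'End(U)) :
  nilpotent_end f -> cancel (lexp (- f)) (lexp f).
Proof. by move=> /nilpotent_endN /lexpNK; rewrite opprK. Qed.

Lemma lexp_bij (U : vectType K) (f : 'End(U)) :
  nilpotent_end f -> bijective (lexp f).
Proof.
by move=> nf; exists (lexp (- f)); [apply: lexpNK | apply: lexpKN].
Qed.

End NilpotentExponential.

#[local] Opaque lexp comp_lfun linfun.

(** * Nilpotency and integrality of weights *)

Section EigenNilpotent.
Context {K : numFieldType} {U : vectType K}.

(** A^k is an eigenvector of the commutator with H, for the eigenvalue k c, as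
    long as it is nonzero; in dimension n there are at most n^2 eigenvalues. *)
Lemma shift_nilpotent (H A : 'End(U)) (c : K) :
  c != 0 -> (forall v, H (A v) - A (H v) = c *: A v) -> nilpotent_end A.
Proof.
move=> c0 HA; pose e := vbasis {:U}; have eb : basis_of {:U} e by apply: vbasisP.
pose B := mxof e e A; pose M := mxof e e H; pose n := \dim {:U}.
exists (n * n)%N => v; apply/eqP; rewrite -(rVof_eq0 eb) rVof_iter -/e -/B.
suff -> : B ^+ (n * n) = 0 by rewrite mulmx0.
have comm1 : B *m M - M *m B = c *: B.
  rewrite -!(mxof_comp e e eb) -linearB -linearZ /=; congr (mxof e e _).
  by apply/lfunP => w; rewrite add_lfunE opp_lfunE !comp_lfunE scale_lfunE HA.
have commk k : B ^+ k *m M - M *m B ^+ k = (k%:R * c) *: B ^+ k.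
  elim: k => [|k IHk]; first by rewrite expr0 mulmx1 mul1mx subrr mul0r scale0r.
  rewrite exprS -mulmxA.
  have -> : B ^+ k *m M = M *m B ^+ k + (k%:R * c) *: B ^+ k.
    by rewrite -IHk addrC subrK.
  rewrite mulmxDr -scalemxAr [B *m (M *m _)]mulmxA.
  have -> : B *m M = M *m B + c *: B by rewrite -comm1 addrC subrK.
  rewrite mulmxDl -scalemxAl mulmxA -[X in X - _]addrA addrAC subrr add0r.
  by rewrite -scalerDl -natr1 mulrDl mul1r addrC.
have [//|Bnn0] := eqVneq (B ^+ (n * n)) 0; exfalso.
pose L : 'M[K]_(n * n) := lin_mulmxr M - lin_mulmx M.
have root_k k : (k <= n * n)%N -> root (char_poly L) (k%:R * c).
  move=> lek; rewrite -eigenvalue_root_char; apply/eigenvalueP.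
  exists (mxvec (B ^+ k)).
    by rewrite mulmxBr !mul_vec_lin /= -linearB -linearZ /= commk.
  rewrite mxvec_eq0; apply: contraNneq Bnn0 => Bk0.
  by rewrite -(subnK lek) exprD Bk0 mulr0.
pose rs := [seq k%:R * c | k <- iota 0 (n * n).+1].
suff : (size rs < size (char_poly L))%N.
  by rewrite size_char_poly size_map size_iota ltnn.
apply: max_poly_roots; first by rewrite monic_neq0 ?char_poly_monic.
  by apply/allP => _ /mapP[k + ->]; rewrite mem_iota => ?; apply: root_k.
rewrite map_inj_uniq ?iota_uniq // => i j /(mulIf c0) /eqP.
by rewrite eqr_nat => /eqP.
Qed.

(** Raising v to a vector w killed by E, of weight mu = lambda + 2 n, and then
    lowering it: E F^(m+1) w = (m + 1) (mu - m) F^m w, so that mu = m for the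
    last nonzero F^m w. *)
Lemma sl2_weight_integral (E F H : 'End(U)) (lambda : K) v :
  (forall v, E (F v) - F (E v) = H v) ->
  (forall v, H (E v) - E (H v) = 2 *: E v) ->
  (forall v, H (F v) - F (H v) = (- 2) *: F v) ->
  v != 0 -> H v = lambda *: v ->
  exists m n : nat, lambda = m%:R - n%:R * 2.
Proof.
move=> EF HE HF v0 Hv.
have [NE E0] : nilpotent_end E by apply: shift_nilpotent HE; rewrite pnatr_eq0.
have [NF F0] : nilpotent_end F.
  by apply: shift_nilpotent HF; rewrite oppr_eq0 pnatr_eq0.
have HEv k : H (iter k E v) = (lambda + k%:R * 2) *: iter k E v.
  elim: k => [|k IHk] /=; first by rewrite mul0r addr0.
  rewrite -[LHS](subrK (E (H (iter k E v)))) HE IHk linearZ /= -scalerDl.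
  by congr (_ *: _); rewrite -(natr1 k); ring.
have top (A : 'End(U)) N w : iter N A w = 0 -> w != 0 ->
    exists2 n, iter n A w != 0 & iter n.+1 A w = 0.
  elim: N => [/= -> /eqP//|N IHN] AN w0.
  by have [/IHN/(_ w0)//|AN0] := eqVneq (iter N A w) 0; exists N.
have [n w0 Ew] := top _ _ _ (E0 v) v0.
set w := iter n E v in w0; have {}Ew : E w = 0 := Ew.
pose mu := lambda + n%:R * 2.
have Hw : H w = mu *: w by apply: HEv.
have HFw k : H (iter k F w) = (mu - k%:R * 2) *: iter k F w.
  elim: k => [|k IHk] /=; first by rewrite mul0r subr0.
  rewrite -[LHS](subrK (F (H (iter k F w)))) HF IHk linearZ /= -scalerDl.
  by congr (_ *: _); rewrite -(natr1 k); ring.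
have EFw k : E (iter k.+1 F w) = (k.+1%:R * (mu - k%:R)) *: iter k F w.
  elim: k => [|k IHk].
    by rewrite /= -[LHS](subrK (F (E w))) EF Hw Ew linear0 addr0 subr0 mul1r.
  rewrite iterS -[LHS](subrK (F (E (iter k.+1 F w)))) EF HFw IHk.
  rewrite [F (_ *: _)]linearZ /=.
  rewrite -iterS -scalerDl; congr (_ *: _); rewrite -(natr1 k.+1) -(natr1 k).
  by ring.
have [m Fm Fm1] := top _ _ _ (F0 w) w0.
exists m, n; apply/eqP; rewrite eq_sym subr_eq eq_sym -subr_eq0.
have := EFw m; rewrite Fm1 linear0 => /esym/eqP; rewrite scaler_eq0 (negPf Fm).
by rewrite orbF mulf_eq0 pnatr_eq0.
Qed.

End EigenNilpotent.

(** * The operators exp(x) exp(-y) exp(x) of an sl2-triple *)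

Section LieModules.
Context {K : numFieldType} {g : vectType K} (br : {bilinear g -> g -> g}).
Hypothesis brL : is_lie_bracket br.

Lemma lie_skew x y : br x y = - br y x.
Proof.
have [alt _] := brL; apply/eqP; rewrite -addr_eq0; apply/eqP.
by have := alt (x + y); rewrite linearDl !linearD /= !alt addr0 add0r addrC.
Qed.

Lemma adE x y : ad br x y = br x y.
Proof. by rewrite /ad lfunE. Qed.

#[local] Opaque ad.

Lemma ad_linear : linear (ad br).
Proof.
by move=> c x y; apply/lfunP => z; rewrite add_lfunE scale_lfunE !adE linearPl.
Qed.

Lemma ad_module x y z :
  ad br (br x y) z = ad br x (ad br y z) - ad br y (ad br x z).
Proof.
rewrite !adE (lie_skew _ z); have [_ /(_ x y z)/eqP] := brL.
rewrite addr_eq0 => /eqP <-.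
by rewrite (lie_skew x z) linearN /= opprK.
Qed.

Section Module.
Context {U : vectType K} (rho : g -> 'End(U)).
Hypothesis rho_linear : linear rho.
Hypothesis rho_module :
  forall x y v, rho (br x y) v = rho x (rho y v) - rho y (rho x v).

Lemma rho0 : rho 0 = 0.
Proof. by have := rho_linear (-1) 0 0; rewrite /= scaler0 addr0 scaleN1r addNr. Qed.

Lemma rhoZ c x : rho (c *: x) = c *: rho x.
Proof. by have := rho_linear c x 0; rewrite /= !addr0 rho0 addr0. Qed.

Lemma rhoN x : rho (- x) = - rho x.
Proof. by rewrite -scaleN1r rhoZ scaleN1r. Qed.

Lemma module_nilpotent c h x :
  c != 0 -> br h x = c *: x -> nilpotent_end (rho x).
Proof.
move=> c0 hx; apply: (shift_nilpotent (H := rho h) c0) => v.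
by rewrite -rho_module hx rhoZ scale_lfunE.
Qed.

Lemma lexp_module x z v : nilpotent_end (rho x) -> nilpotent_end (ad br x) ->
  lexp (rho x) (rho z v) = rho (lexp (ad br x) z) (lexp (rho x) v).
Proof.
move=> nr na; apply: (lexp_leibniz (b := fun z v => rho z v)) => //.
- by move=> w c a b; rewrite rho_linear add_lfunE scale_lfunE.
- by move=> a c w w'; rewrite linearP.
by move=> a w; rewrite adE rho_module subrK.
Qed.
End Module.

Definition is_sl2_triple (x y t : g) : Prop :=
  [/\ br x y = t, br t x = 2 *: x & br t y = (- 2) *: y].

Definition sl2_lift (U : vectType K) (rho : g -> 'End(U)) (x y : g) : 'End(U) :=
  (lexp (rho x) \o lexp (- rho y) \o lexp (rho x))%VF.

Lemma sl2_liftE (U : vectType K) (rho : g -> 'End(U)) x y v :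
  sl2_lift rho x y v = lexp (rho x) (lexp (- rho y) (lexp (rho x) v)).
Proof. by rewrite !comp_lfunE. Qed.

#[local] Opaque sl2_lift.

Section Lift.
Variables (x y t : g).
Hypothesis xyt : is_sl2_triple x y t.

Let n2 : (- 2 : K) != 0. Proof. by rewrite oppr_eq0 pnatr_eq0. Qed.
Let p2 : (2 : K) != 0. Proof. by rewrite pnatr_eq0. Qed.

Section Module.
Context {U : vectType K} (rho : g -> 'End(U)).
Hypothesis rho_linear : linear rho.
Hypothesis rho_module :
  forall x y v, rho (br x y) v = rho x (rho y v) - rho y (rho x v).

Lemma sl2_nilpotent : nilpotent_end (rho x) /\ nilpotent_end (rho y).
Proof.
have [_ tx ty] := xyt; split.
  exact: (module_nilpotent rho_linear rho_module p2 tx).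
exact: (module_nilpotent rho_linear rho_module n2 ty).
Qed.

Lemma sl2_lift_bij : bijective (sl2_lift rho x y).
Proof.
have [/lexp_bij bx /nilpotent_endN /lexp_bij by_] := sl2_nilpotent.
by apply: (eq_bij (bij_comp (bij_comp bx by_) bx)) => v; rewrite sl2_liftE.
Qed.

End Module.

(** The lifts of a Weyl reflection to a module and to g are compatible with the
    action, because each of their three exponential factors is. *)
Lemma sl2_lift_module (U : vectType K) (rho : g -> 'End(U)) :
  linear rho ->
  (forall x y v, rho (br x y) v = rho x (rho y v) - rho y (rho x v)) ->
  forall z v,
  sl2_lift rho x y (rho z v) = rho (sl2_lift (ad br) x y z) (sl2_lift rho x y v).
Proof.
move=> rl rm z v; have [nx ny] := sl2_nilpotent rl rm.
have [ax ay] := sl2_nilpotent ad_linear ad_module.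
have nNy := nilpotent_endN ny; have aNy := nilpotent_endN ay.
have nNy' : nilpotent_end (rho (- y)) by rewrite (rhoN rl).
have aNy' : nilpotent_end (ad br (- y)) by rewrite (rhoN ad_linear).
have := lexp_module rl rm _ _ nx ax; have := lexp_module rl rm _ _ nNy' aNy'.
rewrite !sl2_liftE -(rhoN rl) -(rhoN ad_linear).
move: (lexp (rho x)) (lexp (rho (- y))) => ex ey.
move: (lexp (ad br x)) (lexp (ad br (- y))) => ax' ay' my mx.
by rewrite mx my mx.
Qed.

(** Only the brackets of x, y, t enter, so that this is the conjugation of sl2 by
    the matrix with rows (0, 1) and (-1, 0). *)
Lemma sl2_lift_ad : sl2_lift (ad br) x y x = - y /\ sl2_lift (ad br) x y y = - x.
Proof.
have [xy tx ty] := xyt; have [alt _] := brL.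
have [ax ay] := sl2_nilpotent ad_linear ad_module.
have aNy := nilpotent_endN ay.
have xt : br x t = (- 2) *: x by rewrite lie_skew tx scaleNr.
have yt : br y t = 2 *: y by rewrite lie_skew ty scaleNr opprK.
have yx : br y x = - t by rewrite lie_skew xy.
have s1 (A : 'End(g)) v : nilpotent_end A -> A v = 0 -> lexp A v = v.
  move=> nA Av; rewrite (@lexpE _ _ _ 1 v nA) ?big_ord1 ?fact0 ?invr1 ?scale1r.
    by [].
  exact: Av.
have s2 (A : 'End(g)) v w : nilpotent_end A -> A v = w -> A w = 0 ->
    lexp A v = v + w.
  move=> nA Av Aw; have A2 : iter 2 A v = 0 by rewrite /= Av.
  rewrite (lexpE nA A2) !big_ord_recr big_ord0 /= add0r !invr1 !scale1r Av.
  by [].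
have s3 (A : 'End(g)) v w u : nilpotent_end A -> A v = w -> A w = u -> A u = 0 ->
    lexp A v = v + w + 2^-1 *: u.
  move=> nA Av Aw Au; have A3 : iter 3 A v = 0 by rewrite /= Av Aw.
  rewrite (lexpE nA A3) !big_ord_recr big_ord0 /= add0r !invr1 !scale1r Av Aw.
  by [].
have exx : lexp (ad br x) x = x by apply: (s1 _ _ ax); rewrite adE alt.
have adxt : ad br x t = (- 2) *: x by rewrite adE.
have adxx : ad br x ((- 2) *: x) = 0 by rewrite adE linearZr_LR alt scaler0.
have Nadyt : (- ad br y) t = (- 2) *: y by rewrite opp_lfunE adE yt scaleNr.
have Nadyy : (- ad br y) ((- 2) *: y) = 0.
  by rewrite opp_lfunE adE linearZr_LR alt scaler0 oppr0.
have ext : lexp (ad br x) t = t - (x + x).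
  by rewrite (s2 _ _ _ ax adxt adxx) scaleNr scaler_nat mulr2n.
have half (z : g) : 2^-1 *: ((- 2) *: z) = - z.
  by rewrite scalerA mulrN mulVf // scaleN1r.
have exy : lexp (ad br x) y = y + t - x.
  by rewrite (s3 _ _ t _ ax _ adxt adxx) ?half // adE.
have eyx : lexp (- ad br y) x = x + t - y.
  by rewrite (s3 _ _ t _ aNy _ Nadyt Nadyy) ?half // opp_lfunE adE yx opprK.
have eyt : lexp (- ad br y) t = t - (y + y).
  by rewrite (s2 _ _ _ aNy Nadyt Nadyy) scaleNr scaler_nat mulr2n.
have eyy : lexp (- ad br y) y = y.
  by apply: (s1 _ _ aNy); rewrite opp_lfunE adE alt oppr0.
have dbl (a b : g) : a + (b - (a + a)) = b - a by rewrite addrCA opprD addNKr.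
rewrite !sl2_liftE; move: exx ext exy eyx eyt eyy.
move: (lexp (ad br x)) (lexp (- ad br y)) => ex ey exx ext exy eyx eyt eyy.
rewrite exx eyx exy; split.
  rewrite linearB linearD /= exx ext exy dbl.
  by apply/eqP; rewrite subr_eq -[y + t - x]addrA addKr.
rewrite [ey _]linearB /= [ey (_ + _)]linearD /= eyy eyt eyx dbl.
have -> : t - y - (x + t - y) = - x.
  by apply/eqP; rewrite subr_eq -[x + t - y]addrA addKr.
by rewrite linearN /= exx.
Qed.

(** Write T = exp(x) exp(-y) exp(x).  Since T x = - y T and T (- y) = x T, moving
    T through the product gives T T = exp(-y) exp(x) exp(-y) T, and T is
    invertible. *)
Lemma sl2_lift_braid (U : vectType K) (rho : g -> 'End(U)) :
  linear rho ->
  (forall x y v, rho (br x y) v = rho x (rho y v) - rho y (rho x v)) ->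
  forall v, sl2_lift rho x y v =
    lexp (- rho y) (lexp (rho x) (lexp (- rho y) v)).
Proof.
move=> rl rm w; have [nx ny] := sl2_nilpotent rl rm.
have nNy := nilpotent_endN ny; have [phix phiy] := sl2_lift_ad.
have [T' _ T'K] := sl2_lift_bij rl rm.
have TN : forall v, sl2_lift rho x y (rho x v) = (- rho y) (sl2_lift rho x y v).
  by move=> v; rewrite (sl2_lift_module rl rm) phix (rhoN rl).
have TN' : forall v, sl2_lift rho x y ((- rho y) v) = rho x (sl2_lift rho x y v).
  move=> v; rewrite opp_lfunE linearN /= (sl2_lift_module rl rm) phiy (rhoN rl).
  by rewrite opp_lfunE opprK.
have Tx v := lexp_intertwine v nx nNy TN.
have TNy v := lexp_intertwine v nNy nx TN'.
have TE := sl2_liftE rho x y.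
move: (lexp (rho x)) (lexp (- rho y)) Tx TNy TE => ex ey Tx TNy TE.
by rewrite -(T'K w) -Tx -TNy -Tx -TE.
Qed.

End Lift.
End LieModules.

#[local] Opaque ad.

(** * Unitarity *)

Section Unitary.
Context {C : numClosedFieldType} {U : vectType C} (ip : {dot U for Num.conj}).

Lemma lexp_adjoint (f f' : 'End(U)) :
  nilpotent_end f -> nilpotent_end f' ->
  (forall u v, ip (f u) v = ip u (f' v)) ->
  forall u v, ip (lexp f u) v = ip u (lexp f' v).
Proof.
move=> nf nf' adj u v; have [N f0] := nf; have [M f'0] := nf'.
have fNM : iter (N + M) f u = 0 by rewrite (iter_end_vanish (f0 u)) ?leq_addr.
have f'NM : iter (N + M) f' v = 0 by rewrite (iter_end_vanish (f'0 v)) ?leq_addl.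
have iadj k w : ip (iter k f w) v = ip w (iter k f' v).
  by elim: k w => // k IHk w; rewrite iterSr IHk adj -iterS.
apply: etrans (congr1 (fun w => ip w v) (lexpE nf fNM)) _.
apply: etrans _ (esym (congr1 (ip u) (lexpE nf' f'NM))).
rewrite linear_sumlz linear_sumr.
apply: eq_bigr => k _; rewrite linearZl_LR linearZr_LR /= iadj.
by rewrite fmorphV /= rmorph_nat.
Qed.

Context {g : vectType C} (br : {bilinear g -> g -> g}).
Variables (rho : g -> 'End(U)) (x y t : g).
Hypothesis brL : is_lie_bracket br.
Hypothesis rho_linear : linear rho.
Hypothesis rho_module :
  forall x y v, rho (br x y) v = rho x (rho y v) - rho y (rho x v).
Hypothesis xyt : is_sl2_triple br x y t.

(** The adjoint of exp(x) exp(-y) exp(x) is exp(y) exp(-x) exp(y); once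
    the operator is rewritten as exp(-y) exp(x) exp(-y), the factors cancel one by
    one. *)
Lemma sl2_lift_isometry :
  (forall u v, ip (rho x u) v = ip u (rho y v)) ->
  forall u v, ip (sl2_lift rho x y u) (sl2_lift rho x y v) = ip u v.
Proof.
move=> xy u v; have [nx ny] := sl2_nilpotent xyt rho_linear rho_module.
have yx w w' : ip (- rho y w) w' = ip w (- rho x w').
  rewrite linearNl linearNr /=; congr (- _).
  by rewrite hermC [RHS]hermC /= xy.
have nNx := nilpotent_endN nx; have nNy := nilpotent_endN ny.
rewrite sl2_liftE.
have ax := lexp_adjoint nx ny xy.
have ay : forall w w', ip (lexp (- rho y) w) w' = ip w (lexp (- rho x) w').
  by apply: lexp_adjoint => // w w'; rewrite !opp_lfunE yx.
rewrite (sl2_lift_braid brL xyt rho_linear rho_module).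
have Kx := lexpNK nx; have Ky := lexpKN ny.
move: (lexp (rho x)) (lexp (rho y)) (lexp (- rho x)) (lexp (- rho y)) ax ay Kx Ky.
by move=> ex ey ex' ey' ax ay Kx Ky; rewrite ax ay ax Ky Kx Ky.
Qed.

End Unitary.

(** * The module V + g and its bracket *)

Section Extension.
Context {R : realType} {g V : vectType R[i]}.
Variables (br : {bilinear g -> g -> g}) (rho : {linear g -> 'End(V)}).
Hypothesis brL : is_lie_bracket br.
Hypothesis rhoL : is_lie_module br rho.
Local Notation n := (V * g)%type.

Fact nact_is_linear X : linear (nact br rho X : n -> n).
Proof. by move=> c a b; congr (_, _); rewrite /= linearP. Qed.

HB.instance Definition _ X := GRing.isSemilinear.Build R[i] n n _
  (nact br rho X : n -> n) (GRing.semilinear_linear (nact_is_linear X)).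

Definition nrep (X : g) : 'End(n) := linfun (nact br rho X).

Lemma nrepE X a : nrep X a = (rho X a.1, br X a.2).
Proof. by rewrite lfunE. Qed.

Lemma nrep_linear : linear nrep.
Proof.
move=> c X Y; apply/lfunP => a; rewrite add_lfunE scale_lfunE !nrepE.
congr (_, _) => /=; first by rewrite linearP /= add_lfunE scale_lfunE.
by rewrite linearPl.
Qed.

Lemma nrep_module X Y a :
  nrep (br X Y) a = nrep X (nrep Y a) - nrep Y (nrep X a).
Proof.
rewrite !nrepE /=; congr (_, _); first exact: rhoL.
by have := ad_module brL X Y a.2; rewrite !adE.
Qed.

Lemma sl2_lift_nrep x y t a : is_sl2_triple br x y t ->
  sl2_lift nrep x y a = (sl2_lift rho x y a.1, sl2_lift (ad br) x y a.2).
Proof.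
move=> xyt.
have [nx ny] := sl2_nilpotent xyt nrep_linear nrep_module.
have [rx ry] := sl2_nilpotent xyt (linearP rho) rhoL.
have [ax ay] := sl2_nilpotent xyt (ad_linear br) (ad_module brL).
have nNy := nilpotent_endN ny; have rNy := nilpotent_endN ry.
have aNy := nilpotent_endN ay.
have fstP Y w : (nrep Y w).1 = rho Y w.1 by rewrite nrepE.
have sndP Y w : (nrep Y w).2 = ad br Y w.2 by rewrite nrepE adE.
have fstN Y w : ((- nrep Y) w).1 = (- rho Y) w.1 by rewrite !opp_lfunE -fstP.
have sndN Y w : ((- nrep Y) w).2 = (- ad br Y) w.2.
  by rewrite !opp_lfunE -sndP.
have := lexp_intertwine (t := fst) _ nx rx (fstP _).
have := lexp_intertwine (t := fst) _ nNy rNy (fstN _).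
have := lexp_intertwine (t := snd) _ nx ax (sndP _).
have := lexp_intertwine (t := snd) _ nNy aNy (sndN _).
rewrite !sl2_liftE [LHS]surjective_pairing.
move: (lexp (nrep x)) (lexp (- nrep y)) => nex ney.
move: (lexp (rho x)) (lexp (- rho y)) => rex rey.
move: (lexp (ad br x)) (lexp (- ad br y)) => aex aey.
move=> /= ys xs yf xf.
by congr (_, _); rewrite ?xs ?ys ?xs // xf yf xf.
Qed.

Lemma word_lift_nrep (h : {vspace g}) (X t : dual h -> g) (bs : seq (dual h)) :
  (forall b, b \in bs -> is_sl2_triple br (X b) (X (- b)) (t b)) ->
  forall a, word_lift nrep X bs a =
            (word_lift rho X bs a.1, word_lift (ad br) X bs a.2).
Proof.
elim: bs => [|b bs IHbs] trip a; first by rewrite !id_lfunE; case: a.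
apply: etrans (comp_lfunE _ _ _) _.
rewrite IHbs; last by move=> c cbs; apply: trip; rewrite inE cbs orbT.
apply: etrans (sl2_lift_nrep _ (trip b (mem_head _ _))) _.
by congr (_, _); apply: esym; apply: comp_lfunE.
Qed.

Section Bracket.
Variables (B : {symmetric n}) (brn : {bilinear n -> n -> n}).
Hypothesis Binv : is_invariant_form br rho B.
Hypothesis brnB : is_nil_bracket rho B brn.

Lemma nbracket_fst a b : brn a b = brn (a.1, 0) (b.1, 0).
Proof.
have [brnL cen _ _] := brnB.
have split1 (c : n) : c = (c.1, 0) + (0, c.2).
  by case: c => u v; congr (_, _); rewrite /= ?addr0 ?add0r.
rewrite {1}(split1 a) linearDl cen addr0 {1}(split1 b) linearDr /=.
by rewrite [X in _ + X](lie_skew brnL) cen oppr0 addr0.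
Qed.

(** Pairing with Z in g, and writing [.,.] for the bracket of n,
    B([X,[v,v']], Z) = - B([v,v'], [X,Z]) = - B([X,Z] v, v')
    = B(Z v, X v') + B(Z X v, v') = B([v, X v'], Z) + B([X v, v'], Z). *)
Lemma nbracket_derivation X a b :
  nrep X (brn a b) = brn (nrep X a) b + brn a (nrep X b).
Proof.
have [Bnd Bperp BV Bg] := Binv; have [brnL cen im1 brnZ] := brnB.
rewrite ![brn _ b]nbracket_fst [brn a _]nbracket_fst !nrepE /=.
move: a.1 b.1 => {a b} v v'.
apply/eqP; rewrite -subr_eq0.
set d := (X in X == 0); rewrite -memv0.
move: Bnd; rewrite /nondegenerate => /eqP <-; apply/mem_orthovP => c _.
have brn2 p q : brn p q = (0, (brn p q).2) by rewrite -(im1 p q); case: (brn p q).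
have BgZ Y : B (0, (brn (v, 0) (v', 0)).2) (0, Y) = B (rho Y v, 0) (v', 0).
  by rewrite -brn2 brnZ.
have -> : c = (c.1, 0) + (0, c.2).
  by case: c => p q; congr (_, _); rewrite /= ?addr0 ?add0r.
have d1 : d = (0, d.2).
  rewrite /d [LHS]surjective_pairing; congr (_, _).
  by rewrite /= !im1 linear0 addr0 subr0.
rewrite linearDr /= {1}d1 hermC Bperp rmorph0 mulr0 add0r /d.
rewrite linearBl linearDl /= !brnZ [(brn (v, 0) (v', 0)).1]im1 linear0.
have /eqP := Bg X (brn (v, 0) (v', 0)).2 c.2.
rewrite addr_eq0 => /eqP ->; rewrite BgZ rhoL.
have -> : (rho X (rho c.2 v) - rho c.2 (rho X v), 0) =
    ((rho X (rho c.2 v), 0) - (rho c.2 (rho X v), 0) : n).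
  by congr (_, _); rewrite /= subr0.
have /eqP := BV X (rho c.2 v) v'; rewrite addr_eq0 => /eqP BX.
rewrite linearBl /= BX. ring.
Qed.

Lemma sl2_lift_nbracket x y t a b : is_sl2_triple br x y t ->
  sl2_lift nrep x y (brn a b) = brn (sl2_lift nrep x y a) (sl2_lift nrep x y b).
Proof.
move=> xyt; have [nx ny] := sl2_nilpotent xyt nrep_linear nrep_module.
have nNy := nilpotent_endN ny.
have derN Y c d :
    (- nrep Y) (brn c d) = brn ((- nrep Y) c) d + brn c ((- nrep Y) d).
  by rewrite !opp_lfunE nbracket_derivation opprD linearNl linearNr.
have linl w : linear (brn^~ w) by move=> c u v /=; rewrite linearPl.
have linr w : linear (brn w) by move=> c u v /=; rewrite linearPr.
have ex c d := lexp_leibniz linl linr (nbracket_derivation x) c d nx nx nx.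
have ey c d := lexp_leibniz linl linr (derN y) c d nNy nNy nNy.
rewrite !sl2_liftE.
by move: (lexp (nrep x)) (lexp (- nrep y)) ex ey => f g' ex ey; rewrite ex ey ex.
Qed.

End Bracket.

Section Word.
Context {h : {vspace g}} (X t : dual h -> g) (bs : seq (dual h)).
Hypothesis triples : forall b, b \in bs -> is_sl2_triple br (X b) (X (- b)) (t b).

(** An induction on words in which every letter carries its sl2-triple; being a
    bijection, a morphism or an isometry is stable under composition. *)
Lemma word_lift_ind (P : (n -> n) -> Prop) :
  P id -> (forall f f', P f -> P f' -> P (f \o f')) ->
  (forall b, b \in bs -> P (sl2_lift nrep (X b) (X (- b)))) ->
  P (word_lift nrep X bs).
Proof.
move=> P1 Pcomp; elim: bs => [|b cs IHcs] Pb.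
  rewrite (_ : (word_lift _ _ _ : n -> n) = id) //.
  by apply/funext => a; rewrite id_lfunE.
rewrite (_ : (word_lift _ _ _ : n -> n) =
    sl2_lift nrep (X b) (X (- b)) \o word_lift nrep X cs); last first.
  by apply/funext => a; apply: comp_lfunE.
apply: Pcomp; first by apply: Pb; rewrite mem_head.
by apply: IHcs => c ccs; apply: Pb; rewrite inE ccs orbT.
Qed.

Lemma word_lift_automorphism (B : {symmetric n}) (brn : {bilinear n -> n -> n}) :
  is_invariant_form br rho B -> is_nil_bracket rho B brn ->
  lie_automorphism brn (word_lift nrep X bs).
Proof.
move=> Binv brnB; split; first exact: linearP.
- apply: (word_lift_ind (P := fun f => bijective f)).
  + by exists id.
  + by move=> f f' bf bf'; apply: bij_comp.
  by move=> b /triples tb; apply: (sl2_lift_bij tb nrep_linear nrep_module).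
apply: (word_lift_ind (P := fun f => {morph f : x y / brn x y >-> brn x y})) => //.
- by move=> f f' mf mf' x y /=; rewrite mf' mf.
by move=> b /triples tb x y; apply: (sl2_lift_nbracket Binv brnB _ _ tb).
Qed.

Lemma word_lift_isometry (ip : {dot n for Num.conj}) :
  (forall b, b \in bs -> forall u v,
     ip (nrep (X b) u) v = ip u (nrep (X (- b)) v)) ->
  isometry ip ip (word_lift nrep X bs).
Proof.
move=> adj.
apply: (word_lift_ind (P := fun f => forall u v, ip (f u) (f v) = ip u v)) => //.
- by move=> f f' mf mf' x y /=; rewrite mf mf'.
move=> b bbs u v.
exact: (sl2_lift_isometry brL nrep_linear nrep_module (triples bbs) (adj b bbs)).
Qed.

End Word.
End Extension.

(** * Every root carries an sl2-triple *)

Section Trace.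
Context {K : numFieldType} {U : vectType K}.

Lemma mxtrace_basis (e e' : (\dim {:U}).-tuple U) (f : 'End(U)) :
  basis_of {:U} e -> basis_of {:U} e' ->
  \tr (mxof e e f) = \tr (mxof e' e' f).
Proof.
move=> eb eb'; rewrite -{1}[f]comp_lfun1l (mxof_comp _ _ eb').
rewrite -{1}[f]comp_lfun1r (mxof_comp _ _ eb') -mulmxA mxtrace_mulC -mulmxA.
by rewrite -(mxof_comp _ _ eb) comp_lfun1l (mxof1 (basis_free eb')) mulmx1.
Qed.

(** The diagonal entries are indexed by position, so that basis vectors need not
    be compared. *)
Lemma ltrace_diag (s : seq U) (f : 'End(U)) (c : nat -> K) :
  basis_of {:U} s -> (forall i, (i < size s)%N -> f s`_i = c i *: s`_i) ->
  ltrace f = \sum_(i < size s) c i.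
Proof.
move=> sb fs; have sz : size s == \dim {:U}.
  by apply/eqP; rewrite (size_basis (X := in_tuple s) sb).
rewrite /ltrace (@mxtrace_basis _ (Tuple sz)) ?vbasisP // /mxtrace.
rewrite (eqP sz); apply: eq_bigr => i _; rewrite mxE /= mxE vecof_delta /=.
rewrite fs; last by rewrite (eqP sz).
by rewrite linearZ /= (coord_free _ _ (basis_free (X := Tuple sz) sb)) eqxx mulr1.
Qed.

End Trace.

Lemma bracket_space_mem (K : numFieldType) (L : vectType K)
  (br : {bilinear L -> L -> L}) (U W : {vspace L}) u w :
  u \in U -> w \in W -> br u w \in bracket_space br U W.
Proof.
move=> /coord_vbasis -> /coord_vbasis ->; rewrite linear_sumlz.
apply: memv_suml => i _; rewrite linear_sumr; apply: memv_suml => j _.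
rewrite linearZl_LR linearZr_LR; apply: memvZ; apply: memvZ; apply: memv_span.
by apply: allpairs_f; apply: mem_nth; rewrite size_tuple.
Qed.

Section RootSystem.
Context {R : realType} {g : vectType R[i]} (br : {bilinear g -> g -> g}).
Context {h : {vspace g}} (Delta : seq (dual h)) (X : dual h -> g).
Hypothesis brL : is_lie_bracket br.
Hypothesis h_nil : is_nilpotent br h.
Hypothesis Delta_base : is_base br Delta.

Lemma root_space_bracket (a b : dual h) x y :
  root_space br a x -> root_space br b y -> root_space br (a + b) (br x y).
Proof.
move=> ax bY H; have := ad_module brL (vsval H) x y; rewrite !adE => E.
have -> : br (vsval H) (br x y) = br (br (vsval H) x) y + br x (br (vsval H) y).
  by rewrite E subrK.
by rewrite ax bY linearZl_LR linearZr_LR -scalerDl add_lfunE.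
Qed.

Lemma root_space_root (a : dual h) x :
  root_space br a x -> x != 0 -> a != 0 -> is_root br a.
Proof. by move=> ax x0 a0; split => //; exists x. Qed.

Lemma root_value_neq0 (a : dual h) : a != 0 -> exists H, a H != 0.
Proof.
move=> a0; apply: contrapT => nH; case/eqP: a0; apply/lfunP => H.
by rewrite zero_lfunE; apply: contrapT => aH; apply: nH; exists H; apply/eqP.
Qed.

Section Chevalley.
Variable Phi : seq (dual h).
Hypothesis PhiP : forall a, a \in Phi <-> is_root br a.
Hypothesis chev_basis : basis_of fullv ([seq X b | b <- Phi] ++
                            [seq vsval (tau br a) | a <- Delta]).
Hypothesis X_root : forall b, is_root br b -> root_space br b (X b).
Hypothesis X_tau : forall a, is_root br a -> br (X a) (X (- a)) = vsval (tau br a).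
Hypothesis X_sum : forall a b, is_root br a -> is_root br b -> is_root br (a + b) ->
  exists c, br (X a) (X b) = c *: X (a + b).

Let chev_free := basis_free chev_basis.
Let S := <<[seq X b | b <- Phi]>>%VS.

Lemma X_neq0 b : is_root br b -> X b != 0.
Proof.
move=> /PhiP bPhi; apply: (free_not0 chev_free).
by rewrite mem_cat map_f.
Qed.

Lemma X_mem b : is_root br b -> X b \in S.
Proof. by move=> /PhiP bPhi; apply: memv_span; apply: map_f. Qed.

Lemma nil_iter (H : subvs_of h) x k : x \in h ->
  iter k (ad br (vsval H)) x \in iter k (bracket_space br h) h.
Proof.
move=> xh; elim: k => //= k IHk; rewrite adE.
by apply: bracket_space_mem IHk; apply: subvsP.
Qed.

(** For H in h, ad H is nilpotent on h, while it acts on X_b through the scalar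
    b(H), nonzero for a suitable H. *)
Lemma cartan_roots_disjoint x : x \in h -> x \in S -> x = 0.
Proof.
move=> xh; rewrite /S -[X in <<X>>%VS]in_tupleE => /coord_span.
set s := in_tuple _; set c := fun i => coord s i x => xE.
have fs : free s by move: chev_free; rewrite cat_free => /and3P[].
have si (i : 'I_(size [seq X b | b <- Phi])) : (i < size Phi)%N.
  by rewrite -(size_map X).
have [k k0] := h_nil.
have c0 i : c i = 0.
  have Pi : is_root br Phi`_i by apply/PhiP; rewrite mem_nth.
  have [H aH] := root_value_neq0 Pi.1.
  have : iter k (ad br (vsval H)) x = 0.
    by apply/eqP; rewrite -memv0 -k0; apply: nil_iter.
  have -> : iter k (ad br (vsval H)) x = \sum_i (c i * (Phi`_i H) ^+ k) *: s`_i.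
    elim: (k) => [|m IHm].
      by rewrite [LHS]/= xE; apply: eq_bigr => j _; rewrite expr0 mulr1.
    rewrite iterS IHm linear_sum; apply: eq_bigr => j _.
    rewrite linearZ /= adE (nth_map 0) // X_root; last first.
      by apply/PhiP; rewrite mem_nth.
    by rewrite scalerA exprSr mulrA.
  move/(freeP fs)/(_ i)/eqP; rewrite mulf_eq0 expf_eq0 (negPf aH) andbF orbF.
  by move/eqP.
by rewrite xE big1 // => i _; rewrite -/(c i) c0 scale0r.
Qed.

Lemma bracket_X_cartan (a : dual h) (H : subvs_of h) :
  is_root br a -> br (X a) (vsval H) = - a H *: X a.
Proof. by move=> ra; rewrite (lie_skew brL) (X_root ra) scaleNr. Qed.

(** If -a is not a root, no root vector is sent by ad X_a into the Cartan
    subalgebra: [X_a, X_b] lies in the root space of a + b, which is nonzero. *)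
Lemma bracket_X_mem a u :
  is_root br a -> ~ is_root br (- a : dual h) -> br (X a) u \in S.
Proof.
move=> ra nra; have : u \in fullv by apply: memvf.
rewrite -(span_basis chev_basis) span_cat => /memv_addP[v vS [w wT ->]].
rewrite linearDr /=; apply: memvD; last first.
  have wh : w \in h.
    by move: w wT; apply/subvP/span_subvP => _ /mapP[b _ ->]; apply: subvsP.
  rewrite -(vsprojK wh) bracket_X_cartan //; apply: memvZ; exact: X_mem.
have : v \in <<[seq X b | b <- Phi]>>%VS by [].
rewrite -[X in <<X>>%VS]in_tupleE => /coord_span ->; rewrite linear_sumr.
apply: memv_suml => i _; rewrite linearZr_LR; apply: memvZ.
have si : (i < size Phi)%N by rewrite -(size_map X).
have /PhiP rb : Phi`_i \in Phi by rewrite mem_nth.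
rewrite /= (nth_map 0) //; set b := Phi`_i in rb *.
have ab0 : a + b != 0.
  by apply: contra_notN nra; rewrite addrC addr_eq0 => /eqP <-.
have [->|bab] := eqVneq (br (X a) (X b)) 0; first exact: mem0v.
have rab : is_root br (a + b).
  by apply: root_space_root bab ab0; apply: root_space_bracket; apply: X_root.
by have [c ->] := X_sum ra rb rab; apply: memvZ; apply: X_mem.
Qed.

(** Otherwise tau_a = [X_a, X_{-a}] would be both in h and in the span of the
    root vectors.  Here X_{-a} is an arbitrary element, since the Chevalley
    relations constrain X only at the roots. *)
Lemma tau_neq0_opp a : is_root br a -> tau br a != 0 -> is_root br (- a : dual h).
Proof.
move=> ra; apply: contra_neqP => nra.
apply: (can_inj (@vsvalK _ _ h)); rewrite linear0.
apply: cartan_roots_disjoint; first exact: subvsP.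
by rewrite -X_tau //; apply: bracket_X_mem.
Qed.

Definition dual_vec (a : dual h) (Ha : subvs_of h) :=
  forall H, killing br (vsval H) (vsval Ha) = a H.

Lemma root_vecP a Ha : dual_vec a Ha -> dual_vec a (root_vec br a).
Proof.
move=> aHa; rewrite /root_vec.
by apply: (@xgetPex _ _ (fun Ha => dual_vec a Ha)); exists Ha.
Qed.

(** If no vector is dual to a, the defining choice of H_a falls back on 0; if
    B(H_a, H_a) = 0, the coefficient 2 / 0 is 0.  So tau_a is nonzero only
    in the intended situation. *)
Lemma tau_neq0P a : tau br a != 0 -> dual_vec a (root_vec br a) /\
  killing br (vsval (root_vec br a)) (vsval (root_vec br a)) != 0.
Proof.
rewrite /tau scaler_eq0 negb_or mulf_eq0 invr_eq0 negb_or.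
move=> /andP[/andP[_ k0] v0]; split => //.
move: v0; rewrite /root_vec.
by case: xgetP => [x -> //|_]; rewrite eqxx.
Qed.

Lemma root_triple a : is_root br a -> tau br a != 0 ->
  a (tau br a) = 2 /\ is_sl2_triple br (X a) (X (- a)) (vsval (tau br a)).
Proof.
move=> ra ta; have rNa := tau_neq0_opp ra ta.
have [aH k0] := tau_neq0P ta.
have a2 : a (tau br a) = 2.
  by rewrite /tau linearZ /= -aH -[RHS](divfK k0).
split=> //; split; first exact: X_tau.
  by rewrite (X_root ra) a2.
by rewrite (X_root rNa) opp_lfunE a2.
Qed.

Lemma base_root a : a \in Delta -> is_root br a.
Proof. by have [bD _ _] := Delta_base; apply: bD. Qed.

Lemma base_tau_neq0 a : a \in Delta -> tau br a != 0.
Proof.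
move=> aD; have : vsval (tau br a) != 0.
  apply: (free_not0 chev_free); rewrite mem_cat orbC.
  by rewrite (map_f (fun a => vsval (tau br a))).
by apply: contraNneq => ->; rewrite linear0.
Qed.

(** tau_a = [X_a, X_{-a}] lies in the root space of a + (-a) = 0. *)
Lemma cartan_tau_commute (H : subvs_of h) a :
  a \in Delta -> br (vsval H) (vsval (tau br a)) = 0.
Proof.
move=> aD; have ra := base_root aD.
have rNa := tau_neq0_opp ra (base_tau_neq0 aD).
rewrite -X_tau // (root_space_bracket (X_root ra) (X_root rNa)).
by rewrite subrr zero_lfunE scale0r.
Qed.

Lemma killing_cartan (H H' : subvs_of h) :
  killing br (vsval H) (vsval H') = \sum_(b <- Phi) b H * b H'.
Proof.
rewrite /killing (ltrace_diag (c := fun i => Phi`_i H * Phi`_i H') chev_basis).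
  rewrite (@sum_truncate _ (fun i => Phi`_i H * Phi`_i H') (size Phi)).
  - by rewrite (big_nth 0) big_mkord.
  - by rewrite size_cat size_map leq_addr.
  by move=> k lek; rewrite nth_default // zero_lfunE mul0r.
move=> i ilt; rewrite comp_lfunE !adE nth_cat size_map.
have [iPhi|lei] := ltnP i (size Phi).
  have /PhiP rb : Phi`_i \in Phi by rewrite mem_nth.
  by rewrite (nth_map 0) // (X_root rb) linearZr_LR (X_root rb) scalerA mulrC.
have iD : (i - size Phi < size Delta)%N.
  rewrite ltn_subLR // -(size_map X) -(size_map (fun a => vsval (tau br a))).
  by rewrite -size_cat.
rewrite (nth_map 0) //.
rewrite cartan_tau_commute ?linear0r; last by rewrite mem_nth.
by rewrite nth_default // zero_lfunE mul0r scale0r.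
Qed.

Lemma dualZ (a : dual h) c H : a (c *: H) = c * a H.
Proof. exact: linearZ. Qed.

(** c(tau_a) is the weight of X_c for the triple of a, hence an integer. *)
Lemma root_tau_real a c : a \in Delta -> is_root br c -> c (tau br a) \is Num.real.
Proof.
move=> aD rc; have [_ [xy tx ty]] := root_triple (base_root aD) (base_tau_neq0 aD).
have [||||m [p ->]] := @sl2_weight_integral _ _ (ad br (X a)) (ad br (X (- a)))
    (ad br (vsval (tau br a))) (c (tau br a)) (X c) _ _ _ (X_neq0 rc).
- by move=> v; rewrite -(ad_module brL) xy.
- by move=> v; rewrite -(ad_module brL) tx !adE linearZl_LR.
- by move=> v; rewrite -(ad_module brL) ty !adE linearZl_LR.
- by rewrite adE (X_root rc).
by rewrite realB // ?realM ?realn.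
Qed.

(** tau_a is 2 H_a / k with k = B(H_a, H_a), and 4 / k = B(tau_a, tau_a) is a sum
    of squares of the real numbers c(tau_a); so k is real, and c(H_a) as well. *)
Lemma root_vec_real a c : a \in Delta -> is_root br c ->
  c (root_vec br a) \is Num.real.
Proof.
move=> aD rc; have [_ k0] := tau_neq0P (base_tau_neq0 aD).
have tt_real : killing br (vsval (tau br a)) (vsval (tau br a)) \is Num.real.
  rewrite killing_cartan big_seq; apply: rpred_sum => b /PhiP rb.
  by apply: realM; apply: root_tau_real.
set k := killing br _ _ in k0.
have tauE : tau br a = (2 / k) *: root_vec br a by [].
have tt : killing br (vsval (tau br a)) (vsval (tau br a)) = 4 / k.
  rewrite killing_cartan tauE.
  transitivity ((2 / k) ^+ 2 *
      \sum_(b <- Phi) b (root_vec br a) * b (root_vec br a)).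
    by rewrite mulr_sumr; apply: eq_bigr => b _; rewrite !dualZ expr2 mulrACA.
  rewrite -killing_cartan -/k.
  by field.
have k_real : k \is Num.real.
  have -> : k = 4 / (4 / k) by field.
  by rewrite realM ?realV ?realn // -tt.
have -> : root_vec br a = (k / 2) *: tau br a.
  by rewrite tauE scalerA mulrA divfK // divff // scale1r.
by rewrite linearZ /= realM ?realM ?realV ?realn // root_tau_real.
Qed.

Definition real_dual_vec b Hb :=
  dual_vec b Hb /\ forall c, is_root br c -> c Hb \is Num.real.

Lemma nonneg_comb_dual_vec b : nonneg_comb Delta b -> exists Hb, real_dual_vec b Hb.
Proof.
move=> [k ->]; exists (\sum_(i < size Delta) root_vec br Delta`_i *+ k i); split.
  move=> H; rewrite killing_cartan sum_lfunE.
  transitivity (\sum_(i < size Delta)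
      killing br (vsval H) (vsval (root_vec br Delta`_i)) *+ k i).
    under [RHS]eq_bigr do rewrite killing_cartan -sumrMnl.
    rewrite exchange_big; apply: eq_bigr => c _ /=; rewrite linear_sum mulr_sumr.
    by apply: eq_bigr => i _; rewrite linearMn mulrnAr.
  apply: eq_bigr => i _.
  have iD : Delta`_i \in Delta by rewrite mem_nth.
  have [aH _] := tau_neq0P (base_tau_neq0 iD).
  rewrite aH; elim: (k i) => [|m IHm]; first by rewrite !mulr0n zero_lfunE.
  by rewrite !mulrS add_lfunE IHm.
move=> c rc; rewrite linear_sum; apply: rpred_sum => i _.
by rewrite linearMn /=; apply: rpredMn; apply: root_vec_real; rewrite ?mem_nth.
Qed.

Lemma root_dual_vec b : is_root br b -> exists Hb, real_dual_vec b Hb.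
Proof.
move=> rb; have [_ _ /(_ b rb)[/nonneg_comb_dual_vec//|]] := Delta_base.
move=> /nonneg_comb_dual_vec[Hb [bH realH]]; exists (- Hb); split.
  move=> H; rewrite killing_cartan -[RHS]opprK -opp_lfunE -bH killing_cartan -sumrN.
  by apply: eq_bigr => c _; rewrite linearN mulrN.
by move=> c rc; rewrite linearN /= rpredN; apply: realH.
Qed.

(** Let H_b be a dual vector of b at which the roots are real.  If B(H_b, H_b), the
    sum of the c(H_b)^2, were 0, then all c(H_b) would vanish, and so would
    b(H) = B(H, H_b) for every H.  The dual vector chosen in tau_b may differ
    from H_b, but has the same square. *)
Lemma tau_neq0 (b : dual h) : is_root br b -> tau br b != 0.
Proof.
move=> rb; have [Hb [bH realH]] := root_dual_vec rb.
have bvec := root_vecP bH; set Hb' := root_vec br b in bvec.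
have ksym (H H' : subvs_of h) :
    killing br (vsval H) (vsval H') = killing br (vsval H') (vsval H).
  by rewrite !killing_cartan; apply: eq_bigr => c _; rewrite mulrC.
have kE : killing br (vsval Hb') (vsval Hb') = killing br (vsval Hb) (vsval Hb).
  by rewrite bvec -bH ksym bvec -bH.
have k0 : killing br (vsval Hb) (vsval Hb) != 0.
  apply: contraPneq rb => /esym/eqP; rewrite killing_cartan => k0 [b0 _].
  have cH c : c \in Phi -> c Hb = 0.
    have sq_ge0 d : d \in Phi -> 0 <= d Hb * d Hb.
      by move=> /PhiP rd; rewrite -expr2 real_exprn_even_ge0 // realH.
    move=> cPhi; apply/eqP; move: k0; rewrite eq_sym big_seq psumr_eq0; last first.
      by move=> d dPhi; apply: sq_ge0.
    by move=> /allP/(_ c cPhi); rewrite cPhi /= mulf_eq0 orbb.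
  case/eqP: b0; apply/lfunP => H; rewrite -bH killing_cartan zero_lfunE big_seq.
  by rewrite big1 // => c cPhi; rewrite cH // mulr0.
rewrite /tau -/Hb' kE scaler_eq0 negb_or mulf_neq0 ?pnatr_eq0 ?invr_eq0 //=.
apply: contraNneq k0 => Hb'0; rewrite -kE killing_cartan big1 // => c _.
by rewrite Hb'0 linear0 mul0r.
Qed.

Lemma root_sl2_triple b : is_root br b ->
  is_sl2_triple br (X b) (X (- b)) (vsval (tau br b)).
Proof. by move=> rb; case: (root_triple rb (tau_neq0 rb)). Qed.

End Chevalley.
End RootSystem.

(** * The action of the compact form *)

Section CompactForm.
Context {R : realType} {g V : vectType R[i]}.
Variables (br : {bilinear g -> g -> g}) (rho : {linear g -> 'End(V)}).
Local Notation n := (V * g)%type.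

Lemma real_span_gen (S : set g) x : S x -> real_span S x.
Proof.
move=> Sx; exists 1%N, (fun=> 1), (fun=> x); split => //.
by rewrite big_ord1 scale1r.
Qed.

(** With P, Q the actions of x, y: skewness of P - Q reads P - Q = Q^* - P^*, and
    skewness of i (P + Q) reads P + Q = P^* + Q^*, as i is anti-self-adjoint. *)
Lemma compact_adjoint (g0 : set g) (ip : {dot n for Num.conj}) x y :
  is_invariant_product br rho g0 ip ->
  g0 (x - y) -> g0 ('i%C *: x + 'i%C *: y) ->
  (forall u v, ip (nrep br rho x u) v = ip u (nrep br rho y v)) /\
  (forall u v, ip (nrep br rho y u) v = ip u (nrep br rho x v)).
Proof.
move=> inv gm gp.
have skm u v := inv _ gm u v; have skp u v := inv _ gp u v.
have nE z u : nact br rho z u = nrep br rho z u by rewrite nrepE.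
have nl := nrep_linear br rho.
have nD z w : nrep br rho (z + w) = nrep br rho z + nrep br rho w.
  by have := nl 1 z w; rewrite !scale1r.
have E u v : ip (nrep br rho x u) v - ip (nrep br rho y u) v =
    - (ip u (nrep br rho x v) - ip u (nrep br rho y v)).
  have := skm u v; rewrite !nE nD (rhoN nl) !add_lfunE !opp_lfunE.
  rewrite linearDl linearDr linearNl linearNr /=.
  by [].
have conji : Num.conj ('i%C : R[i]) = - 'i%C by rewrite complexiE conjCi.
have i0 : ('i%C : R[i]) != 0 by rewrite complexiE neq0Ci.
have F u v : ip (nrep br rho x u) v + ip (nrep br rho y u) v =
    ip u (nrep br rho x v) + ip u (nrep br rho y v).
  have := skp u v; rewrite !nE -scalerDr (rhoZ nl) !scale_lfunE nD !add_lfunE.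
  rewrite linearZl_LR linearZr_LR /= conji mulNr opprK => /(mulfI i0).
  by rewrite linearDl linearDr.
have half (p q p' q' : R[i]) : p - q = - (p' - q') -> p + q = p' + q' ->
    p = q' /\ q = p'.
  move=> e1 e2; split.
    by transitivity (((p - q) + (p + q)) / 2); [field | rewrite e1 e2; field].
  by transitivity (((p + q) - (p - q)) / 2); [field | rewrite e1 e2; field].
by split=> u v; have [] := half _ _ _ _ (E u v) (F u v).
Qed.
End CompactForm.

Theorem proposition5p3 (R : realType) (g : vectType R[i])
  (br : {bilinear g -> g -> g}) (h : {vspace g}) (Delta : seq (dual h))
  (X : dual h -> g)
  (V : vectType R[i]) (rho : {linear g -> 'End(V)})
  (Bstar : {symmetric (V * g)%type})
  (brn : {bilinear (V * g)%type -> (V * g)%type -> (V * g)%type})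
  (expr : (subvs_of h -> subvs_of h) -> seq (dual h)) :
  is_lie_bracket br -> is_semisimple br -> is_cartan_subalgebra br h ->
  is_base br Delta -> is_chevalley_basis br Delta X ->
  is_lie_module br rho ->
  is_invariant_form br rho Bstar ->
  is_nil_bracket rho Bstar brn ->
  (forall sigma, weyl_group br sigma ->
     (forall b, b \in expr sigma -> is_root br b) /\
     sigma =1 refl_word br (expr sigma)) ->
  forall sigma, weyl_group br sigma ->
  let T := word_lift rho X (expr sigma) in
  let phi := word_lift (ad br) X (expr sigma) in
  let zeta := fun x : V * g => (T x.1, phi x.2) in
  lie_automorphism brn zeta /\
  forall ip : {dot (V * g)%type for Num.conj},
    is_invariant_product br rho (compact_form br Delta X) ip ->
    (forall v Y, ip (v, 0) (0, Y) = 0) ->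
    isometry ip ip zeta.
Proof.
move=> brL _ [_ h_nil _] Dbase [[Phi [_ PhiP basis]] X_root X_tau [C X_C]].
move=> rhoL Binv brnB expr_roots sigma /expr_roots[sigma_roots _] T phi zeta.
have X_sum a b : is_root br a -> is_root br b -> is_root br (a + b) ->
    exists c, br (X a) (X b) = c *: X (a + b).
  by move=> ra rb rab; have [-> _] := X_C a b ra rb rab; exists (C a b).
have triples b (bs : b \in expr sigma) :=
  root_sl2_triple brL h_nil Dbase PhiP basis X_root X_tau X_sum
    (sigma_roots b bs).
have -> : zeta = word_lift (nrep br rho) X (expr sigma).
  by apply/funext => a; rewrite (word_lift_nrep brL rhoL triples).
split; first exact: (word_lift_automorphism brL rhoL triples Binv brnB).
move=> ip ip_inv _; apply: (word_lift_isometry brL rhoL triples).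
move=> b /sigma_roots rb.
have rNb : is_root br (- b : dual h).
  apply: (tau_neq0_opp brL h_nil PhiP basis X_root X_tau X_sum rb).
  exact: (tau_neq0 brL h_nil Dbase PhiP basis X_root X_tau X_sum rb).
have adj c : is_positive_root br Delta c ->
    (forall u v, ip (nrep br rho (X c) u) v = ip u (nrep br rho (X (- c)) v)) /\
    (forall u v, ip (nrep br rho (X (- c)) u) v = ip u (nrep br rho (X c) v)).
  move=> pc; apply: (compact_adjoint ip_inv); apply: real_span_gen.
    by left; right; exists c.
  by right; exists c.
(* The compact form involves positive roots only; for b negative, adjointness is
   obtained from -b. *)
have [_ _ /(_ b rb)[pb|pNb]] := Dbase.
  by have [] := adj b (conj rb pb).
by have [_] := adj (- b) (conj rNb pNb); rewrite opprK.
Qed.
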